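(* Let $p$ be an odd prime, $K$ an algebraically closed field of characteristic $p$, and $g\ge 1$ an integer. Let $(\lambda_1,\ldots,\lambda_{2g-1})\in K^{2g-1}$ be any common solution of the equations $$c_{ip-j}(z_1,\ldots,z_{2g-1})=0\qquad(1\le i,j\le g).$$ Then the curve $y^2=x(x-1)(x-\lambda_1)(x-\lambda_2)\cdots(x-\lambda_{2g-1})$ is nonsingular; more precisely, the $2g+1$ elements $0,1,\lambda_1,\ldots,\lambda_{2g-1}$ of $K$ are pairwise distinct.
   Context: Let $f(x)=x(x-1)(x-z_1)(x-z_2)\cdots(x-z_{2g-1})$ with $z_1,\ldots,z_{2g-1}$ indeterminates over $\mathbb{F}_p$. For an integer $k$, $c_k\in\mathbb{F}_p[z_1,\ldots,z_{2g-1}]$ denotes the coefficient of $x^k$ in $f(x)^{(p-1)/2}$ (so $c_k=0$ if $k<0$ or $k>(p-1)(2g+1)/2$). The polynomials $c_{ip-j}$, $1\le i,j\le g$, are the entries of the Cartier--Manin matrix of $y^2=f(x)$. *)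

(* Defs.v *)
From HB Require Import structures.
From mathcomp Require Import all_boot all_order all_algebra.
From mathcomp Require Import mpoly.

Set Implicit Arguments.
Unset Strict Implicit.
Unset Printing Implicit Defensive.

Import GRing.Theory.
Local Open Scope ring_scope.

Definition rosenhain (R : comNzRingType) (n : nat) (z : 'I_n -> R) : {poly R} :=
  'X * ('X - 1) * \prod_(i < n) ('X - (z i)%:P).

(* The coefficient of x^k in f^((p-1)/2) for f with indeterminate roots
   z_1, ..., z_{2g-1}; k is an int because the indices ip - j can be negative,
   and the coefficient is then 0. *)
Definition cm_coef (p g : nat) (k : int) : {mpoly 'F_p[(2 * g).-1]} :=
  if k is Posz m then
    ((rosenhain (fun i : 'I_(2 * g).-1 => 'X_i : {mpoly 'F_p[(2 * g).-1]}))
       ^+ (p.-1)./2)`_m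
  else 0.

(* Value at a K-point of a polynomial over 'F_p. The residue a is sent to the
   image of its representative in {0, ..., p - 1}; for p prime this is a
   ring morphism (the only one 'F_p -> K) exactly when K has characteristic p. *)
Definition Fp_eval (p : nat) (K : fieldType) (n : nat) (v : 'I_n -> K)
    (P : {mpoly 'F_p[n]}) : K :=
  mmap (fun a : 'F_p => (a : nat)%:R) v P.

(* The plane curve G = 0 over an algebraically closed field K: the partial
   derivatives of G have no common zero on it. *)
Definition nonsingular_curve (K : closedFieldType) (G : {mpoly K[2]}) : Prop :=
  forall v : 'I_2 -> K, G.@[v] = 0 -> exists i : 'I_2, (G^`M(i)).@[v] != 0.

(* y^2 - F(x), with x = 'X_0 and y = 'X_1. *)
Definition double_cover_eq (K : fieldType) (F : {poly K}) : {mpoly K[2]} :=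
  'X_1 ^+ 2 - (map_poly (@mpolyC 2 K) F).['X_0].

(* Main.v *)
(** Put F = f^n with n = (p - 1)/2, and call a polynomial q exact when it is a
    derivative, i.e. q^`(p.-1) = 0; exactness only depends on q up to p-th
    powers. The equations c_{ip-j} = 0 say that q F is exact for every q of
    degree < g, a condition that no longer refers to the origin.

    If a root a had even multiplicity 2k, then (X - a)^(k-1) F would be a p-th
    power times (X - a)^(p-1) u with u(a) <> 0, which is not exact. So
    f = f1 s^2 with f1 the product of X - b over the distinct roots, and
    s F = s^p f1^n. As f has two distinct roots, deg s < g, hence f1^n is exact;
    and if s(a) = 0, then E = f1^n/(X - a) is exact as well. Let G be a primitive
    of f1^n and R = (G E)^`(p.-1). At a root b <> a, G - G(b) is divisible by
    (X - b)^(n+1), so (X - b)^p divides R; counting degrees, R = 0. But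
    G - G(a) = (X - a)^(n+1) w with w(a) <> 0 gives R(a) <> 0. On the curve
    y^2 = f1(x) this is the vanishing of the sum of the residues of phi psi',
    where phi' = 1/y and psi' = 1/((x - a) y). *)
Require Import Defs.
From HB Require Import structures.
From mathcomp Require Import all_boot all_order all_algebra.
From mathcomp Require Import separable mpoly zify ring.

Set Implicit Arguments.
Unset Strict Implicit.
Unset Printing Implicit Defensive.

Import GRing.Theory.
Local Open Scope ring_scope.

(** * Derivatives of order [p.-1] and primitives in characteristic [p] *)

Lemma odd_eq_half_pred (p : nat) : odd p -> p = (p.-1)./2.*2.+1.
Proof. by case: p => //= p even_p; rewrite even_halfK. Qed.

(** The falling factorial is the product of the p - 1 consecutive integers m + 1, ..., m + p - 1,
    which miss a multiple of p exactly when m is one. *)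
Lemma dvdn_ffact_pred (p m : nat) : prime p ->
  (p %| (p.-1 + m) ^_ p.-1)%N = ~~ (p %| m)%N.
Proof.
move=> p_pr; have p_gt0 := prime_gt0 p_pr.
rewrite ffact_prod Euclid_dvd_prod // big_has_cond /=.
apply/hasP/idP => [[i _ /= dvd_i]|p_ndvd_m].
  apply: contraL dvd_i => /dvdnP[k ->]; have := ltn_ord i.
  have -> : (p.-1 + k * p - i = k * p + (p.-1 - i))%N by have := ltn_ord i; lia.
  by rewrite dvdn_addr ?dvdn_mull // => lt_ip; rewrite gtnNdvd //; lia.
have r_gt0 : (0 < m %% p)%N by rewrite lt0n.
have r_ltp : (m %% p < p)%N by rewrite ltn_mod.
have lt_r : ((m %% p).-1 < p.-1)%N by lia.
exists (Ordinal lt_r); first exact: mem_index_enum.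
rewrite /= {1}(divn_eq m p).
have -> : (p.-1 + (m %/ p * p + m %% p) - (m %% p).-1 = (m %/ p).+1 * p)%N.
  by move: (m %/ p)%N (m %% p)%N r_gt0 r_ltp lt_r => a b; rewrite mulSn; lia.
exact: dvdn_mull.
Qed.

Lemma derivn_predP (K : fieldType) (p : nat) (q : {poly K}) :
  p \in [pchar K] ->
  q^`(p.-1) = 0 <-> forall i, q`_(p.-1 + i * p) = 0.
Proof.
move=> charK; have p_pr := pcharf_prime charK.
split=> [/polyP q0 i | q0].
  have := q0 (i * p)%N; rewrite coef_derivn coef0 -mulr_natr => /eqP.
  by rewrite mulf_eq0 -(dvdn_pcharf charK) dvdn_ffact_pred // dvdn_mull //= orbF => /eqP.
apply/polyP => m; rewrite coef_derivn coef0.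
have [/dvdnP[i ->]|p_ndvd_m] := boolP (p %| m)%N; first by rewrite q0 mul0rn.
rewrite -mulr_natr; have /eqP -> : ((p.-1 + m) ^_ p.-1)%:R == 0 :> K.
  by rewrite -(dvdn_pcharf charK) dvdn_ffact_pred.
by rewrite mulr0.
Qed.

Lemma derivn_expM (K : fieldType) (p m : nat) (A q : {poly K}) :
  p \in [pchar K] -> (A ^+ p * q)^`(m) = A ^+ p * q^`(m).
Proof.
move=> charK; elim: m => [//|m IHm].
rewrite !derivnS IHm derivM deriv_exp -mulr_natr -polyC_natr.
by rewrite (pcharf0 charK) mulr0 mul0r add0r.
Qed.

Lemma horner_derivn_expXsubC (R : comNzRingType) (k : nat) (b : R) (w : {poly R}) :
  (('X - b%:P) ^+ k * w)^`(k).[b] = w.[b] *+ k`!.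
Proof.
elim: k w => [|k IHk] w; first by rewrite expr0 mul1r.
rewrite derivSn derivM deriv_exp derivXsubC mul1r /=.
have -> : ('X - b%:P) ^+ k *+ k.+1 * w + ('X - b%:P) ^+ k.+1 * w^`()
   = ('X - b%:P) ^+ k * (w *+ k.+1 + ('X - b%:P) * w^`()).
  by rewrite exprS -mulr_natr -[w *+ _]mulr_natr; ring.
by rewrite IHk hornerD hornerMn hornerM hornerXsubC subrr mul0r addr0 -mulrnA factS.
Qed.

Lemma derivn_pred_expXsubC_neq0 (K : fieldType) (p : nat) (b : K) (w : {poly K}) :
  p \in [pchar K] -> w.[b] != 0 -> (('X - b%:P) ^+ p.-1 * w)^`(p.-1) != 0.
Proof.
move=> charK wb_neq0; apply/eqP => /(congr1 (fun q => q.[b])).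
rewrite horner_derivn_expXsubC horner0 -mulr_natr => /eqP.
rewrite mulf_eq0 (negPf wb_neq0) -(dvdn_pcharf charK) -ffactnn.
by rewrite -[X in X ^_ _]addn0 dvdn_ffact_pred ?dvdn0 ?(pcharf_prime charK).
Qed.

Lemma antiderivative (K : fieldType) (p : nat) (F : {poly K}) :
  p \in [pchar K] -> F^`(p.-1) = 0 ->
  exists2 G, G^`() = F & (size G <= (size F).+1)%N.
Proof.
move=> charK /(derivn_predP _ charK) F0.
have p_gt0 := prime_gt0 (pcharf_prime charK).
exists (\poly_(i < (size F).+1) (F`_i.-1 / i%:R)); last exact: size_poly.
apply/polyP => i; rewrite coef_deriv coef_poly ltnS /=.
case: ltnP => [_|/(nth_default 0) ->]; last by rewrite mul0rn.
rewrite -[X in X = _]mulr_natr.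
have [/eqP|i_neq0] := eqVneq (i.+1%:R : K) 0; last by rewrite divfK.
rewrite -(dvdn_pcharf charK) => /dvdnP[[//|k] def_i].
suff -> : i = (p.-1 + k * p)%N by rewrite F0 !mul0r.
by move: def_i; rewrite mulSn; lia.
Qed.

(** Since k < p, the integers 1, ..., k are invertible in K, so integration raises the order of
    vanishing at b as in characteristic 0. The relation between [u.[b]] and [w.[b]] serves to show
    [w.[b]] nonzero. *)
Lemma antiderivative_expansion (K : fieldType) (p k : nat) (b : K) (G u : {poly K}) :
  p \in [pchar K] -> (k < p)%N -> G^`() = ('X - b%:P) ^+ k * u ->
  exists2 w, G = G.[b]%:P + ('X - b%:P) ^+ k.+1 * w & u.[b] = w.[b] *+ k.+1.
Proof.
move=> charK k_ltp dG.
have X0 : 'X - b%:P != 0 :> {poly K} by rewrite polyXsubC_eq0.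
suff [w Gw] : exists w : {poly K}, G = G.[b]%:P + ('X - b%:P) ^+ k.+1 * w.
  exists w => //; move: dG; rewrite {1}Gw derivD derivC add0r derivM deriv_exp.
  rewrite derivXsubC mul1r /= -mulr_natr exprSr -!mulrA -mulrDr.
  move/(mulfI (expf_neq0 _ X0)) => <-.
  by rewrite hornerD !hornerM hornerXsubC subrr mul0r addr0 -polyC_natr hornerC mulr_natl.
suff expand j : (j <= k)%N ->
    exists w : {poly K}, G = G.[b]%:P + ('X - b%:P) ^+ j.+1 * w by exact: expand.
elim: j => [|j IHj] le_jk.
  have /factor_theorem[w Gw] : root (G - G.[b]%:P) b.
    by rewrite rootE !hornerE subrr.
  by exists w; rewrite expr1 mulrC -Gw addrC subrK.
have [w Gw] := IHj (ltnW le_jk).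
have /factor_theorem[v def_w] : root w b.
  have : ('X - b%:P) ^+ j * (w *+ j.+1 + ('X - b%:P) * w^`()) =
         ('X - b%:P) ^+ j * (('X - b%:P) ^+ (k - j.+1).+1 * u).
    rewrite mulrA -exprD -subSn // subSS subnKC ?(ltnW le_jk) // -dG {1}Gw.
    rewrite derivD derivC add0r derivM deriv_exp derivXsubC mul1r /= exprSr.
    by rewrite -[w *+ _]mulr_natr -[_ *+ j.+1]mulr_natr; ring.
  move/(mulfI (expf_neq0 _ X0))/(congr1 (fun q => q.[b])).
  rewrite exprS !hornerE hornerMn subrr !mul0r addr0 -[w.[b] *+ _]mulr_natr => /eqP.
  rewrite mulf_eq0 -(dvdn_pcharf charK) gtnNdvd ?orbF //.
  exact: leq_ltn_trans le_jk k_ltp.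
by exists v; rewrite {1}Gw def_w [in RHS]exprSr -mulrA [v * _]mulrC.
Qed.

(** * Exactness and distinct roots *)

Lemma dvdp_exp_prod_XsubC (K : fieldType) (k : nat) (s : seq K) (q : {poly K}) :
  uniq s -> {in s, forall b, ('X - b%:P) ^+ k %| q} ->
  (\prod_(b <- s) ('X - b%:P)) ^+ k %| q.
Proof.
elim: s => [|b s IHs] /=; first by rewrite big_nil expr1n dvd1p.
case/andP=> b_notin_s uniq_s dvd_q; rewrite big_cons exprMn Gauss_dvdp.
  rewrite dvd_q ?mem_head //= IHs // => c c_in_s.
  by rewrite dvd_q // inE c_in_s orbT.
apply: coprimep_expl; apply: coprimep_expr.
by rewrite coprimep_sym coprimep_XsubC root_prod_XsubC.
Qed.

(** With f1 = (X - a) h, the two vanishing derivatives are the exactness of f1^n and of f1^n / (X -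
    a). *)
Lemma exact_pole_contra (K : fieldType) (p : nat) (a : K) (s : seq K) :
  p \in [pchar K] -> odd p -> uniq (a :: s) -> s != [::] ->
  let h := \prod_(b <- s) ('X - b%:P) in
  (('X - a%:P) ^+ (p.-1)./2 * h ^+ (p.-1)./2)^`(p.-1) = 0 ->
  (('X - a%:P) ^+ ((p.-1)./2).-1 * h ^+ (p.-1)./2)^`(p.-1) = 0 -> False.
Proof.
move=> charK odd_p /= /andP[a_notin_s uniq_s] s_neq0.
set h := \prod_(b <- s) _; set n := (p.-1)./2 => F_exact E_exact.
have p_gt1 := prime_gt1 (pcharf_prime charK).
have def_p : p = n.*2.+1 by exact: odd_eq_half_pred.
have n_gt0 : (0 < n)%N by lia.
have lt_np : (n < p)%N by lia.
have [G dG sizeG] := antiderivative charK F_exact.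
move: F_exact E_exact sizeG; set F := _ * h ^+ n; set E := _ * h ^+ n => F_exact E_exact sizeG.
have h_monic : h \is monic by exact: monic_prod_XsubC.
have sizehX m : size (h ^+ m) = (size s * m).+1.
  have := size_exp h m; rewrite size_prod_XsubC /= => <-.
  by rewrite prednK // lt0n size_poly_eq0 monic_neq0 ?monic_exp.
have sizeXh m1 m2 : size (('X - a%:P) ^+ m1 * h ^+ m2) = (m1 + size s * m2).+1.
  rewrite size_monicM ?monic_exp ?monicXsubC ?monic_neq0 //.
    by rewrite size_exp_XsubC sizehX addSn addnS.
  exact: monic_exp.
have ha_neq0 : h.[a] != 0 by rewrite -rootE root_prod_XsubC.
pose R := (G * E)^`(p.-1).
have R_dvd b : b \in s -> ('X - b%:P) ^+ p %| R.
  rewrite -root_prod_XsubC -/h => /factor_theorem[e def_h].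
  have def_F : F = ('X - b%:P) ^+ n * (('X - a%:P) ^+ n * e ^+ n).
    by rewrite /F def_h exprMn; ring.
  have [w Gw _] := antiderivative_expansion charK lt_np (etrans dG def_F).
  (* The constant G(b) contributes nothing because E is exact; the exponents n + 1 from G - G(b) and
     n from E add up to p, and a p-th power passes through derivatives. *)
  have -> : R = ('X - b%:P) ^+ p * (w * ('X - a%:P) ^+ n.-1 * e ^+ n)^`(p.-1).
    rewrite -derivn_expM // /R {1}Gw mulrDl derivnD mul_polyC derivnZ E_exact scaler0 add0r.
    congr (_^`(_)); rewrite /E def_h exprMn def_p -addnn -addSn exprD; ring.
  exact: dvdp_mulr.
have R0 : R = 0.
  apply/eqP; apply: contraTT (dvdp_exp_prod_XsubC uniq_s R_dvd) => R_neq0.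
  apply/negP => /(dvdp_leq R_neq0); rewrite sizehX.
  (* Hence deg R is at most (p - 1) |s|, less than the degree p |s| of h^p since s is nonempty. *)
  have : (size (G * E)%R <= p.-1 + (p.-1 * size s).+1)%N.
    apply: leq_trans (size_polyMleq _ _) _; move: sizeG; rewrite /F /E !sizeXh.
    by rewrite def_p /= -!muln2; nia.
  move=> sizeGE sizeR.
  have : (size R <= (p.-1 * size s).+1)%N.
    apply/leq_sizeP => j le_j; rewrite coef_derivn nth_default ?mul0rn //.
    by apply: leq_trans sizeGE _; rewrite leq_add2l.
  have : (0 < size s)%N by rewrite lt0n size_eq0.
  move: sizeR; rewrite -{1}(prednK (ltnW p_gt1)) mulnS (mulnC p.-1).
  by move: (size s * p.-1)%N (size s) (size R); clear => m t r; lia.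
have [w Gw hw] := antiderivative_expansion charK lt_np dG.
have wa_neq0 : w.[a] != 0.
  apply: contra_eq_neq hw => ->.
  by rewrite mul0rn horner_exp expf_neq0.
suff : R != 0 by rewrite R0 eqxx.
(* At a the exponents n + 1 and n - 1 add up to only p - 1, so R(a) is (p - 1)! times a nonzero
   value. *)
have -> : R = (('X - a%:P) ^+ p.-1 * (w * h ^+ n))^`(p.-1).
  rewrite /R {1}Gw mulrDl derivnD mul_polyC derivnZ E_exact scaler0 add0r.
  congr (_^`(_)).
  have -> : p.-1 = (n.+1 + n.-1)%N by lia.
  by rewrite exprD /E; ring.
apply: derivn_pred_expXsubC_neq0 => //.
by rewrite hornerM horner_exp mulf_neq0 ?expf_neq0.
Qed.

Lemma uniq_roots_of_exact (K : fieldType) (p g : nat) (rs : seq K) :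
  p \in [pchar K] -> odd p -> size rs = g.*2.+1 -> (1 < size (undup rs))%N ->
  (forall q : {poly K}, (size q <= g)%N ->
     (q * (\prod_(b <- rs) ('X - b%:P)) ^+ (p.-1)./2)^`(p.-1) = 0) ->
  uniq rs.
Proof.
move=> charK odd_p size_rs size_D; set f := \prod_(b <- rs) _; set n := (p.-1)./2.
move=> exact_f.
have p_gt1 := prime_gt1 (pcharf_prime charK).
have def_p : p = n.*2.+1 by exact: odd_eq_half_pred.
have n_gt0 : (0 < n)%N by lia.
pose D := undup rs; pose m b := count_mem b rs.
have uniq_rem a : a \in rs -> uniq (a :: rem a D).
  move=> a_rs; rewrite -(perm_uniq (perm_to_rem _)) ?undup_uniq //.
  by rewrite mem_undup.
have def_f : f = \prod_(b <- D) ('X - b%:P) ^+ m b by rewrite prodr_undup_exp_count.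
have odd_m a : a \in rs -> odd (m a).
  move=> a_rs; apply: contraT => even_m.
  have def_m : m a = (m a)./2.*2 by rewrite even_halfK.
  have k_gt0 : (0 < (m a)./2)%N.
    by move: a_rs; rewrite -has_pred1 has_count -/(m a); lia.
  have k_le_g : ((m a)./2 <= g)%N.
    by have := count_size (pred1 a) rs; rewrite -/(m a) size_rs; lia.
  move: def_m k_gt0 k_le_g; set k := (m a)./2 => def_m k_gt0 k_le_g.
  pose h := \prod_(b <- rem a D) ('X - b%:P) ^+ m b.
  have ha_neq0 : h.[a] != 0.
    rewrite horner_prod prodf_seq_neq0; apply/allP => b /= b_in.
    rewrite horner_exp hornerXsubC expf_neq0 // subr_eq0.
    by apply: contraTneq b_in => <-; case/andP: (uniq_rem a a_rs).
  have := exact_f (('X - a%:P) ^+ k.-1); rewrite size_exp_XsubC prednK // => /(_ k_le_g).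
  (* The exponent of X - a is (k - 1) + 2kn = (k - 1) p + (p - 1), because p = 2n + 1. *)
  have -> : ('X - a%:P) ^+ k.-1 * f ^+ n
      = (('X - a%:P) ^+ k.-1) ^+ p * (('X - a%:P) ^+ p.-1 * h ^+ n).
    rewrite def_f (big_rem a) /= -/h; last by rewrite mem_undup.
    rewrite exprMn !mulrA -!exprM -!exprD; congr (_ ^+ _ * _).
    by rewrite def_m def_p -!muln2; case: (k) k_gt0 => //= k' _; lia.
  rewrite derivn_expM // => /eqP; rewrite mulf_eq0 !expf_eq0 polyXsubC_eq0 !andbF /=.
  by apply: contraLR => _; rewrite derivn_pred_expXsubC_neq0 // horner_exp expf_neq0.
apply: count_mem_uniq => a; rewrite -/(m a).
have [a_rs|] := boolP (a \in rs); last by move/count_memPn.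
apply/eqP; apply: contraT => m_neq1.
have k_gt0 : (0 < (m a)./2)%N by have := odd_m a a_rs; lia.
pose s := \prod_(b <- D) ('X - b%:P) ^+ (m b)./2.
pose f1 := \prod_(b <- D) ('X - b%:P).
have s_monic : s \is monic by apply: monic_prod => b _; rewrite monic_exp ?monicXsubC.
have f1_monic : f1 \is monic by exact: monic_prod_XsubC.
have f_f1s : f = f1 * s ^+ 2.
  rewrite -prodrXl -big_split def_f /=; apply: eq_big_seq => b.
  rewrite mem_undup => /odd_m odd_mb; rewrite -exprM -exprS.
  by congr (_ ^+ _); lia.
(* From 2g + 1 = |D| + 2 deg s and |D| >= 2 it follows that deg s < g. *)
have size_s : (size s <= g)%N.
  have : size (f1 * s ^+ 2) = (size rs).+1 by rewrite -f_f1s size_prod_XsubC.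
  rewrite size_monicM ?monic_neq0 ?monic_exp // size_prod_XsubC size_rs -/D.
  have := size_exp s 2; have : (0 < size s)%N by rewrite size_poly_gt0 monic_neq0.
  have : (0 < size (s ^+ 2))%N by rewrite size_poly_gt0 monic_neq0 ?monic_exp.
  by move: size_D; rewrite -/D; move: (size (s ^+ 2)) (size s) (size D); clear; lia.
have /factor_theorem[s' def_s] : root s a.
  rewrite /s (big_rem a) ?mem_undup //= -(prednK k_gt0) exprS -mulrA rootM.
  by rewrite root_XsubC eqxx.
have a_D : a \in D by rewrite mem_undup.
pose h := \prod_(b <- rem a D) ('X - b%:P).
have def_f1 : f1 = ('X - a%:P) * h by rewrite /f1 (big_rem a).
(* Used for q = s, where w = f1^n, and for q = s' = s / (X - a), where w = f1^n / (X - a). *)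
have exact_div (q w : {poly K}) :
    (size q <= g)%N -> q * f ^+ n = s ^+ p * w -> w^`(p.-1) = 0.
  move=> /exact_f + def_qf; rewrite def_qf derivn_expM // => /eqP.
  by rewrite mulf_eq0 expf_eq0 (negPf (monic_neq0 s_monic)) andbF => /eqP.
have sp : s ^+ p = s * s ^+ n.*2 by rewrite -exprS -def_p.
have fn : f ^+ n = ('X - a%:P) ^+ n * h ^+ n * s ^+ n.*2.
  by rewrite f_f1s def_f1 exprMn -exprM mul2n exprMn.
exfalso.
apply: (exact_pole_contra charK odd_p (uniq_rem a a_rs)).
- by rewrite -size_eq0 size_rem //; move: size_D; rewrite -/D; case: (size D) => [|[]].
- by apply: (exact_div s) => //; rewrite fn sp -/n -/h; ring.
apply: (exact_div s').
  apply: leq_trans size_s; rewrite def_s size_Mmonic ?monicXsubC ?size_XsubC ?addn2 //.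
  by apply: contraTneq s_monic => s'0; rewrite def_s s'0 mul0r monicE lead_coef0 eq_sym oner_eq0.
rewrite fn sp [X in _ = X * _ * _]def_s -/n -/h -{1}(prednK n_gt0) exprS; ring.
Qed.

Lemma derivn_pred_mul_eq0 (K : fieldType) (p g : nat) (q F : {poly K}) :
  p \in [pchar K] -> (size q <= g)%N -> (size F <= g * p + p - g)%N ->
  (forall i j, (i < g)%N -> (j < g)%N -> (j <= p.-1 + i * p)%N ->
     F`_(p.-1 + i * p - j) = 0) ->
  (q * F)^`(p.-1) = 0.
Proof.
move=> charK size_q size_F F0; apply/(derivn_predP _ charK) => i.
have p_gt0 := prime_gt0 (pcharf_prime charK).
rewrite coefM big1 // => -[j /=]; rewrite ltnS => le_j _.
have [lt_jg|le_gj] := ltnP j g; last by rewrite nth_default ?mul0r // (leq_trans size_q).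
have [lt_ig|le_gi] := ltnP i g; first by rewrite F0 ?mulr0.
rewrite [F`_ _]nth_default ?mulr0 // (leq_trans size_F) //.
have := leq_mul2r p g i; rewrite le_gi orbT; move: le_j.
by move: (g * p)%N (i * p)%N; lia.
Qed.

(** * Evaluation of the Cartier-Manin entries at a point of K *)

Section FpEval.
Context (p : nat) (K : fieldType) (charK : p \in [pchar K]).

(* Only a ring morphism thanks to charK, hence the phantom argument. *)
Definition Fp_emb of p \in [pchar K] : 'F_p -> K := fun a => (a : nat)%:R.

Let Fp_natr_mod m : (m %% (Zp_trunc (pdiv p)).+2)%:R = m%:R :> K.
Proof. by rewrite Fp_cast ?(pcharf_prime charK) // (GRing.natr_mod_pchar charK). Qed.

Lemma Fp_emb_is_zmod_morphism : zmod_morphism (Fp_emb charK).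
Proof.
move=> a b; apply: (canRL (addrK _)).
by rewrite /Fp_emb -natrD -Fp_natr_mod -[in RHS](subrK b a).
Qed.

Lemma Fp_emb_is_monoid_morphism : monoid_morphism (Fp_emb charK).
Proof. by split=> // a b; rewrite /Fp_emb -natrM -[RHS]Fp_natr_mod. Qed.

HB.instance Definition _ :=
  GRing.isZmodMorphism.Build _ _ (Fp_emb charK) Fp_emb_is_zmod_morphism.
HB.instance Definition _ :=
  GRing.isMonoidMorphism.Build _ _ (Fp_emb charK) Fp_emb_is_monoid_morphism.

Lemma Fp_eval_cm_coef (g m : nat) (lambda : 'I_(2 * g).-1 -> K) :
  Fp_eval lambda (cm_coef p g m%:Z) = (rosenhain lambda ^+ (p.-1)./2)`_m.
Proof.
(* The bare cast is replaced by the convertible [Fp_emb charK], which carries the ring morphism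
   structure. *)
rewrite /Fp_eval -[mmap _ _]/(mmap (Fp_emb charK) lambda) /cm_coef -coef_map /=.
rewrite rmorphXn; congr ((_ ^+ _ : {poly K})`_m).
rewrite !rmorphM rmorphB rmorph1 rmorph_prod /= map_polyX; congr (_ * _).
apply: eq_bigr => i _.
by rewrite rmorphB /= map_polyX map_polyC /= mmapX mmap1U.
Qed.
End FpEval.

Lemma rosenhain_prod (K : fieldType) (n : nat) (z : 'I_n -> K) :
  rosenhain z = \prod_(b <- [:: 0, 1 & [seq z i | i : 'I_n]]) ('X - b%:P).
Proof. by rewrite !big_cons big_image mulrA subr0. Qed.

(** * Partial derivatives and nonsingularity of the plane curve *)

Lemma meval_lift_horner (K : fieldType) (n : nat) (v : 'I_n -> K) (i : 'I_n)
    (F : {poly K}) : ((map_poly (@mpolyC n K) F).['X_i]).@[v] = F.[v i].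
Proof.
elim/poly_ind: F => [|F c IHF]; first by rewrite rmorph0 !horner0 meval0.
rewrite rmorphD rmorphM /= map_polyX map_polyC !hornerMXaddC mevalD mevalM IHF.
by rewrite mevalXU mevalC.
Qed.

Lemma mderivXU (R : nzRingType) (n : nat) (i j : 'I_n) :
  ('X_i)^`M(j) = (i == j)%:R :> {mpoly R[n]}.
Proof.
rewrite mderivX mnm1E; case: eqVneq => [->|_]; last by rewrite scale0r.
have -> : (U_(j) - U_(j) = 0 :> 'X_{1..n})%MM.
  by apply/mnmP => k; rewrite mnmBE subnn mnm0E.
by rewrite scale1r mpolyX0.
Qed.

Lemma mderiv_lift_horner (K : fieldType) (n : nat) (i j : 'I_n) (F : {poly K}) :
  ((map_poly (@mpolyC n K) F).['X_i])^`M(j) =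
    (map_poly (@mpolyC n K) F^`()).['X_i] *+ (i == j).
Proof.
elim/poly_ind: F => [|F c IHF].
  by rewrite deriv0 rmorph0 horner0 mderiv0 mul0rn.
rewrite derivMXaddC !rmorphD !rmorphM /= map_polyX map_polyC hornerMXaddC.
rewrite mderivD mderivC addr0 mderivM mderivXU IHF hornerD hornerMX.
by case: (i == j); rewrite ?mulr0n ?mulr1n ?mulr1 ?mul0r ?mulr0 ?addr0 // addrC.
Qed.

Lemma nonsingular_double_cover (K : closedFieldType) (rs : seq K) :
  (2%:R : K) != 0 -> uniq rs ->
  nonsingular_curve (double_cover_eq (\prod_(b <- rs) ('X - b%:P))).
Proof.
move=> two_neq0 uniq_rs v; set F := \prod_(b <- rs) _.
have F_sep : coprimep F F^`().
  by have := separable_prod_XsubC rs; rewrite unlock uniq_rs => ->.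
rewrite /double_cover_eq mevalB expr2 mevalM mevalXU meval_lift_horner => curve_v.
(* If y = 0, then x is a root of F and the x-derivative -F'(x) is nonzero by separability; otherwise
   the y-derivative 2y is nonzero. *)
have [y0|y_neq0] := eqVneq (v 1) 0; [exists 0 | exists 1].
  rewrite mderivB mderivM !mderivXU mderiv_lift_horner eqxx mulr1n.
  rewrite mul0r mulr0 addr0 sub0r mevalN oppr_eq0 meval_lift_horner.
  apply: coprimep_root F_sep _; move/eqP: curve_v.
  by rewrite y0 mul0r sub0r oppr_eq0.
rewrite mderivB mderivM !mderivXU mderiv_lift_horner eqxx mulr0n subr0 mul1r mulr1.
by rewrite -mulr2n mevalMn mevalXU -mulr_natr mulf_neq0.
Qed.

Theorem theoremB (p : nat) (p_prime : prime p) (p_odd : odd p)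
    (K : closedFieldType) (charK : p \in [pchar K])
    (g : nat) (g_ge1 : (1 <= g)%N)
    (lambda : 'I_(2 * g).-1 -> K)
    (lambda_sol : forall i j : nat, (1 <= i <= g)%N -> (1 <= j <= g)%N ->
       Fp_eval lambda (cm_coef p g (i%:Z * p%:Z - j%:Z)) = 0) :
  nonsingular_curve (double_cover_eq (rosenhain lambda)) /\
  uniq [:: 0, 1 & [seq lambda i | i : 'I_(2 * g).-1]].
Proof.
set rs := [:: _, _ & _].
have size_rs : size rs = g.*2.+1 by rewrite /= size_image card_ord; lia.
suff uniq_rs : uniq rs.
  split=> //; rewrite rosenhain_prod; apply: nonsingular_double_cover => //.
  by rewrite -(dvdn_pcharf charK) dvdn_prime2 //; apply: contraTneq p_odd => ->.
apply: (uniq_roots_of_exact charK p_odd size_rs) => [|q size_q].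
  (* The fixed roots 0 and 1 supply the two distinct roots required. *)
  have sub01 : {subset [:: 0; 1] <= undup rs}.
    by move=> b; rewrite mem_undup !inE => /orP[]->; rewrite ?orbT.
  by apply: (uniq_leq_size _ sub01); rewrite /= inE eq_sym oner_eq0.
rewrite -rosenhain_prod; apply: (derivn_pred_mul_eq0 charK size_q).
  rewrite rosenhain_prod -/rs; set f := \prod_(b <- rs) _.
  have := size_exp f (p.-1)./2; rewrite size_prod_XsubC size_rs /=.
  have := odd_eq_half_pred p_odd.
  by move: (size (f ^+ _)) => k; move: (p.-1)./2 => n ->; rewrite -!muln2; nia.
move=> i j lt_ig lt_jg le_j; rewrite -(Fp_eval_cm_coef charK).
rewrite -(lambda_sol i.+1 j.+1) //; congr (Fp_eval _ (cm_coef _ _ _)).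
(* The bound [le_j] keeps the integer index (i + 1) p - (j + 1) nonnegative, so it equals the
   truncated difference p - 1 + ip - j. *)
rewrite -PoszM subzn; last by rewrite mulSn; lia.
by congr Posz; rewrite mulSn; lia.
Qed.
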